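(* Let $\mathcal{X}\subset\mathbb{R}^d$ be open, $\nu\in\mathcal{P}_2(\mathcal{X}\times\mathcal{X})$, let $A:\mathcal{X}\to\mathbb{R}$ be measurable with $|A(x)|\le C(1+|x|)$ for all $x\in\mathcal{X}$ and some $C>0$, and let $k:\mathcal{X}\times\mathcal{X}\to\mathbb{R}$ be a symmetric positive definite kernel that is continuous on $\mathcal{X}\times\mathcal{X}$ and satisfies $0<k(x,x)\le C(1+|x|^2)$ for all $x\in\mathcal{X}$ and some $C>0$. Assume that $\nu(\cdot,\mathcal{X})$ is a nondegenerate Borel measure, i.e. $\nu(U,\mathcal{X})>0$ for every nonempty open $U\subset\mathcal{X}$, and that $m_A(\cdot;\nu)\in\mathcal{L}_2^\nu$. Then for any $\lambda>0$ $$\bigl\|P_{\overline{\mathcal{H}}}m_A(\cdot;\nu)-m^\lambda_A(\cdot;\nu)\bigr\|_{\mathcal{L}_2^\nu}^2=\sum_{n\in J}\frac{\lambda^2}{(\sigma_n+\lambda)^2}\langle m_A(\cdot;\nu),a_n\rangle_{\mathcal{L}_2^\nu}^2.$$ In particular, $\|P_{\overline{\mathcal{H}}}m_A(\cdot;\nu)-m^\lambda_A(\cdot;\nu)\|_{\mathcal{L}_2^\nu}\to0$ as $\lambda\searrow0$. If, moreover, $P_{\overline{\mathcal{H}}}m_A(\cdot;\nu)\in\mathcal{H}$, then $$\bigl\|P_{\overline{\mathcal{H}}}m_A(\cdot;\nu)-m^\lambda_A(\cdot;\nu)\bigr\|_{\mathcal{H}}^2=\sum_{n\in J}\frac{\lambda^2}{(\sigma_n+\lambda)^2\sigma_n}\langle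 m_A(\cdot;\nu),a_n\rangle_{\mathcal{L}_2^\nu}^2,$$ and thus $\|P_{\overline{\mathcal{H}}}m_A(\cdot;\nu)-m^\lambda_A(\cdot;\nu)\|_{\mathcal{H}}\to0$ as $\lambda\searrow0$.
   Context: A symmetric kernel $k:\mathcal{X}\times\mathcal{X}\to\mathbb{R}$ is called positive definite if $\sum_{i,j=1}^n c_ic_jk(x_i,x_j)\ge 0$ for all $n$, $c_i\in\mathbb{R}$, $x_i\in\mathcal{X}$. Its reproducing kernel Hilbert space (RKHS) $\mathcal{H}$ is the unique Hilbert space of functions $f:\mathcal{X}\to\mathbb{R}$ containing all $k(x,\cdot)$ and satisfying $f(x)=\langle f,k(x,\cdot)\rangle_{\mathcal{H}}$ for all $f\in\mathcal{H}$, $x\in\mathcal{X}$. $\mathcal{P}_2(\mathcal{X}\times\mathcal{X})$ is the set of Borel probability measures with finite second moment; $\nu(U,\mathcal{X}):=\nu(U\times\mathcal{X})$ is the first marginal of $\nu$, and $\mathcal{L}_2^\nu:=L_2(\mathcal{X},\nu(dx,\mathcal{X}))$. The true conditional expectation is $m_A(x;\nu):=\mathsf{E}_{(X,Y)\sim\nu}[A(Y)\mid X=x]$. For $\lambda>0$, $m^\lambda_A(\cdot;\nu)\in\mathcal{H}$ is the (unique) minimizer $$m^\lambda_A(\cdot;\nu):=\mathop{\mathrm{arg\,min}}_{f\in\mathcal{H}}\Bigl\{\int_{\mathcal{X}\times\mathcal{X}}|A(y)-f(x)|^2\,\nu(dx,dy)+\lambda\|f\|_{\mathcal{H}}^2\Bigr\}.$$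 Under the stated assumptions every $f\in\mathcal{H}$ has at most linear growth, so $\mathcal{H}\subset\mathcal{L}_2^\nu$. The operator $T^\nu:\mathcal{L}_2^\nu\to\mathcal{L}_2^\nu$, $T^\nu f:=\int_{\mathcal{X}}k(\cdot,x)f(x)\,\nu(dx,\mathcal{X})$, is self-adjoint, compact and positive semidefinite. $(a_n)_{n\in\mathbb{N}}$ denotes an orthonormal system in $\mathcal{L}_2^\nu$ of eigenfunctions of $T^\nu$ with corresponding eigenvalues $\sigma_1\ge\sigma_2\ge\dots\ge0$, and $J:=\{n\in\mathbb{N}:\sigma_n>0\}$, such that $T^\nu f=\sum_{n\in J}\sigma_n\langle f,a_n\rangle_{\mathcal{L}_2^\nu}a_n$ for all $f\in\mathcal{L}_2^\nu$; for $n\in J$ the $a_n$ are taken to be continuous. By a known generalization of Mercer's theorem (which may be used), when $\nu(\cdot,\mathcal{X})$ is nondegenerate, $(\sqrt{\sigma_n}a_n)_{n\in J}$ is an orthonormal basis of $\mathcal{H}$ and $\langle f,g\rangle_{\mathcal{H}}=\sum_{n\in J}\sigma_n^{-1}\langle f,a_n\rangle_{\mathcal{L}_2^\nu}\langle g,a_n\rangle_{\mathcal{L}_2^\nu}$ for $f,g\in\mathcal{H}$. $P_{\overline{\mathcal{H}}}$ is the orthogonal projection in $\mathcal{L}_2^\nu$ onto the closure $\overline{\mathcal{H}}$ of $\mathcal{H}$ in $\mathcal{L}_2^\nu$, so that $P_{\overline{\mathcal{H}}}f=\sum_{n\in J}\langle f,a_n\rangle_{\mathcal{L}_2^\nu}a_n$.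 *)

(* Defs.v *)
From HB Require Import structures.
From mathcomp Require Import all_boot all_order all_algebra.
From mathcomp Require Import all_classical all_reals all_analysis.

Set Implicit Arguments.
Unset Strict Implicit.
Unset Printing Implicit Defensive.

Import Order.TTheory GRing.Theory Num.Theory.
Import numFieldNormedType.Exports.

Local Open Scope classical_set_scope.
Local Open Scope ring_scope.

(* A nonempty subset X of R^d seen as a space of its own: subspace topology and
   Borel sigma-algebra. Nonemptiness is only there because measurable types are
   pointed in the library; the existence of a probability measure on X * X
   forces it anyway. The product sigma-algebra on X * X is the Borel one, since
   X is second countable. *)
Definition domain (R : realType) (d : nat) (X : set 'rV[R]_d)
  (X0 : X !=set0) : Type := X.

Section domain_instances.
Context (R : realType) (d : nat) (X : set 'rV[R]_d) (X0 : X !=set0).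

Definition domain_point : domain X0 :=
  exist _ (projT1 (cid X0)) (mem_set (projT2 (cid X0))).

HB.instance Definition _ := Topological.copy (domain X0) (X : Type).
HB.instance Definition _ := isPointed.Build (domain X0) domain_point.
HB.instance Definition _ :=
  Measurable.copy (domain X0) (g_sigma_algebraType (@open (domain X0))).

(* The Euclidean norm; the library's norm on row vectors is the sup norm. *)
Definition enorm (x : domain X0) : R := Num.sqrt (\sum_i (\val x) 0 i ^+ 2).

End domain_instances.

Section rkhs.
Context (R : realType) (T : Type).
Implicit Types (k : T -> T -> R) (H : set (T -> R))
  (ip : (T -> R) -> (T -> R) -> R).

Definition symmetric_kernel k := forall x y, k x y = k y x.

Definition posdef_kernel k := forall (n : nat) (c : 'I_n -> R) (x : 'I_n -> T),
  0 <= \sum_i \sum_j c i * c j * k (x i) (x j).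

Definition hnorm ip (f : T -> R) : R := Num.sqrt (ip f f).

(* (H, ip) is the reproducing kernel Hilbert space of k; ip is only meaningful
   on H. *)
Record is_rkhs k H ip : Prop := IsRKHS {
  rkhs_zero : H (cst 0) ;
  rkhs_linear : forall a f g, H f -> H g -> H (a \*o f \+ g) ;
  rkhs_ip_sym : forall f g, H f -> H g -> ip f g = ip g f ;
  rkhs_ip_linear : forall a f g h, H f -> H g -> H h ->
    ip (a \*o f \+ g) h = a * ip f h + ip g h ;
  rkhs_ip_gt0 : forall f, H f -> f <> cst 0 -> 0 < ip f f ;
  rkhs_complete : forall u : nat -> T -> R, (forall n, H (u n)) ->
    (forall e, 0 < e -> \forall m & n \near \oo, hnorm ip (u m \- u n) < e) ->
    exists2 f, H f & hnorm ip (u n \- f) @[n --> \oo] --> (0 : R) ;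
  rkhs_kernel : forall x, H (k x) ;
  rkhs_reproducing : forall f x, H f -> f x = ip f (k x) }.

End rkhs.

Section L2.
Context d (T : measurableType d) (R : realType)
  (mu : {measure set T -> \bar R}).
Implicit Types (f g p : T -> R) (V : set (T -> R)) (k : T -> T -> R).

(* Elements of L2(mu) are represented by functions. *)
Definition L2 : set (T -> R) := [set f | f \in Lfun mu 2%:E].

Definition L2norm f : \bar R := 'N[mu]_2%:E[EFin \o f]%E.

Definition L2ip f g : R := \int[mu]_x (f x * g x).

Definition L2closure V : set (T -> R) :=
  [set f | L2 f /\
    forall e : R, 0 < e -> exists2 g, V g & (L2norm (f \- g)%R < e%:E)%E].

(* p is a representative of the orthogonal projection of f onto the closure
   of V in L2(mu). *)
Definition is_L2proj V f p :=
  L2closure V p /\ forall g, L2closure V g -> L2ip (f \- p) g = 0.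

Definition kernel_op k f : T -> R := fun x => \int[mu]_y (k x y * f y).

Definition pos_indices (sigma : nat -> R) : set nat :=
  [set n | 0 < sigma n].

Record is_eigensystem k (a : nat -> T -> R) (sigma : nat -> R) : Prop :=
  IsEigensystem {
  eigen_L2 : forall n, L2 (a n) ;
  eigen_orthonormal : forall m n, L2ip (a m) (a n) = (m == n)%:R ;
  eigen_ge0 : forall n, 0 <= sigma n ;
  eigen_nonincreasing : forall m n, (m <= n)%N -> sigma n <= sigma m ;
  eigen_eq : forall n,
    {ae mu, forall x, kernel_op k (a n) x = sigma n * a n x} ;
  eigen_expansion : forall f, L2 f ->
    L2norm (fun x => kernel_op k f x -
      \sum_(0 <= n < N | n \in pos_indices sigma)
        sigma n * L2ip f (a n) * a n x) @[N --> \oo] --> 0%E }.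

End L2.

Section regression.
Context d (T : measurableType d) (R : realType).

Section marginal.
Variable nu : probability (T * T)%type R.

Definition marginal1 : set T -> \bar R := pushforward nu fst.

Let marginal10 : marginal1 set0 = 0%E.
Proof. by rewrite /marginal1 /pushforward preimage_set0 measure0. Qed.

Let marginal1_ge0 A : (0 <= marginal1 A)%E.
Proof. exact: measure_ge0. Qed.

Let marginal1_sigma_additive : semi_sigma_additive marginal1.
Proof.
move=> F mF tF mUF.
rewrite /marginal1 /pushforward preimage_bigcup.
apply: measure_semi_sigma_additive.
- by move=> n; rewrite -[X in measurable X]setTI; exact: measurable_fst.
- apply/trivIsetP => /= i j _ _ ij; rewrite -preimage_setI.
  by move/trivIsetP : tF => /(_ _ _ _ _ ij) ->//; rewrite preimage_set0.
- by rewrite -preimage_bigcup -[X in measurable X]setTI; exact: measurable_fst.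
Qed.

HB.instance Definition _ := isMeasure.Build _ _ _ marginal1
  marginal10 marginal1_ge0 marginal1_sigma_additive.

Let marginal1_setT : marginal1 [set: T] = 1%E.
Proof. by rewrite /marginal1 /pushforward preimage_setT probability_setT. Qed.

HB.instance Definition _ := Measure_isProbability.Build _ _ _ marginal1
  marginal1_setT.

End marginal.

(* m is a version of x |-> E[A(Y) | X = x] for (X, Y) distributed as nu. *)
Definition is_condexp (nu : probability (T * T)%type R) (A m : T -> R) :=
  (marginal1 nu).-integrable setT (EFin \o m) /\
  forall U, measurable U ->
    (\int[marginal1 nu]_(x in U) (m x)%:E =
     \int[nu]_(z in U `*` setT) (A z.2)%:E)%E.

Definition krr_loss (nu : probability (T * T)%type R) (A : T -> R)
    (ip : (T -> R) -> (T -> R) -> R) (lambda : R) (f : T -> R) : \bar R :=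
  (\int[nu]_z (`|A z.2 - f z.1| ^+ 2)%:E + (lambda * hnorm ip f ^+ 2)%:E)%E.

Definition is_krr_minimizer (nu : probability (T * T)%type R) (A : T -> R)
    (H : set (T -> R)) (ip : (T -> R) -> (T -> R) -> R) (lambda : R)
    (f : T -> R) :=
  H f /\ forall g, H g ->
    (krr_loss nu A ip lambda f <= krr_loss nu A ip lambda g)%E.

End regression.

(* Main.v *)
(* Riesz representation turns the kernel operator T into a map from L2 to H with
   <T f, g>_H = <f, g>_L2. Hence the eigenfunctions a_n with sigma_n > 0 lie in H
   and are orthogonal there with squared norms 1 / sigma_n; they are complete in
   H because w orthogonal to all of them gives T w = 0, so <w, w>_L2 = 0, and w
   vanishes by continuity and nondegeneracy. This yields Parseval identities in H
   and in the L2-closure of H. Testing the first-order condition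
   <m - m^lambda, g>_L2 = lambda <m^lambda, g>_H against g = a_n shows that the
   n-th coefficient of P m - m^lambda is lambda / (sigma_n + lambda) <m, a_n>. *)
Require Import Defs.
From HB Require Import structures.
From mathcomp Require Import all_boot all_order all_algebra.
From mathcomp Require Import all_classical all_reals all_analysis.
From mathcomp Require Import measurable_realfun ring lra.

Set Implicit Arguments.
Unset Strict Implicit.
Unset Printing Implicit Defensive.

Import Order.TTheory GRing.Theory Num.Theory.
Import numFieldNormedType.Exports.

Local Open Scope classical_set_scope.
Local Open Scope ring_scope.

(** * Semi-inner products *)

(** Elements of L2 are plain functions, so [L2ip] is only semidefinite, and each inner product is
    meaningful only on a set of functions. One abstract notion, a semidefinite form [B] on a subset
    [S] of a vector space, therefore serves [H], L2 of the marginal and L2 of [nu]; limits are then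
    unique only up to null vectors. Fourier expansions converge in [H] by its completeness. The
    embedding bound [L2ip mu f f <= K * ip f f] carries them to L2, and approximation extends them
    to the closure of [H]. The loss lives on [T * T], whereas [m] is known only through integrals
    over sets. The bridge is the orthogonality of A(Y) - m(X) to every square integrable function of
    X. As lambda tends to 0, the factors lambda^2 / (sigma_n + lambda)^2 tend to 0 for each n, but
    not uniformly when sigma_n tends to 0. What saves both limits is that the factors stay below 1
    and the weights are summable: <m, a_n>^2 by Parseval in the closure, <m, a_n>^2 / sigma_n by
    Parseval in [H]. *)

(** For [0 < a] the vertex [t = - b / a] is tested; for [a = 0] and [b != 0] the chosen [t] makes
    the right side [- (c + 1)]. It serves Cauchy-Schwarz, near-minimizers in the Riesz theorem, and,
    with [c = 0], the first-order condition of the regression. *)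
Lemma discriminant_le (R : realFieldType) (a b c : R) : 0 <= a ->
  (forall t, - c <= 2 * t * b + t ^+ 2 * a) -> b ^+ 2 <= c * a.
Proof.
rewrite le_eqVlt => /predU1P[<-|a0] h.
  have [->|b0] := eqVneq b 0; first by rewrite expr0n mulr0.
  have := h (- (c + 1) / (2 * b)); rewrite mulr0 addr0.
  have -> : 2 * (- (c + 1) / (2 * b)) * b = - (c + 1) by field.
  by lra.
have := h (- b / a).
have -> : 2 * (- b / a) * b + (- b / a) ^+ 2 * a = - (b ^+ 2 / a).
  by field; rewrite gt_eqF.
by rewrite lerN2 ler_pdivrMr.
Qed.

Lemma cvg0_sqrt (R : realType) (I : Type) (F : set_system I) {FF : Filter F}
  (u : I -> R) : u i @[i --> F] --> (0 : R) ->
  Num.sqrt (u i) @[i --> F] --> (0 : R).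
Proof.
move=> u0; rewrite -[0 in X in _ --> X]sqrtr0.
exact: (continuous_cvg FF (@sqrt_continuous R 0) u0).
Qed.

Lemma cvg0_sqrtK (R : realType) (I : Type) (F : set_system I) {FF : Filter F}
  (u : I -> R) : (forall i, 0 <= u i) ->
  Num.sqrt (u i) @[i --> F] --> (0 : R) -> u i @[i --> F] --> (0 : R).
Proof.
move=> u0 h; have -> : u = (fun i => Num.sqrt (u i) * Num.sqrt (u i)).
  by apply/funext => i; rewrite -expr2 sqr_sqrtr.
by rewrite -[0 in X in _ --> X](mulr0 0); exact: cvgM.
Qed.

Section semi_inner.
Context (R : realType) (V : lmodType R).

(** No definiteness is asked for, since a function vanishing almost everywhere is a nonzero null
    vector of L2. *)
Record semi_inner (S : set V) (B : V -> V -> R) : Prop := SemiInner {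
  si0 : S 0 ;
  siDZ : forall a f g, S f -> S g -> S (a *: f + g) ;
  siC : forall f g, S f -> S g -> B f g = B g f ;
  siDZl : forall a f g h, S f -> S g -> S h ->
    B (a *: f + g) h = a * B f h + B g h ;
  si_ge0 : forall f, S f -> 0 <= B f f }.

Context (S : set V) (B : V -> V -> R) (SB : semi_inner S B).

Lemma siD f g : S f -> S g -> S (f + g).
Proof. by move=> Sf Sg; rewrite -[f]scale1r; exact: (siDZ SB). Qed.

Lemma siZ a f : S f -> S (a *: f).
Proof. by move=> Sf; rewrite -[_ *: _]addr0; apply: (siDZ SB) => //; exact: si0 SB. Qed.

Lemma siN f : S f -> S (- f).
Proof. by rewrite -scaleN1r; exact: siZ. Qed.

Lemma siB f g : S f -> S g -> S (f - g).
Proof. by move=> Sf Sg; exact/siD/siN. Qed.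

Lemma si_sum (P : pred nat) (F : nat -> V) N : (forall n, P n -> S (F n)) ->
  S (\sum_(0 <= n < N | P n) F n).
Proof.
by move=> SF; apply: big_ind => //; [exact: si0 SB|exact: siD].
Qed.

Lemma siDl f g h : S f -> S g -> S h -> B (f + g) h = B f h + B g h.
Proof.
by move=> Sf Sg Sh; rewrite -{1}[f]scale1r (siDZl SB)// mul1r.
Qed.

Lemma si0l h : S h -> B 0 h = 0.
Proof.
move=> Sh; have := siDl (si0 SB) (si0 SB) Sh; rewrite addr0 => /eqP.
by rewrite -subr_eq0 opprD addrA subrr add0r oppr_eq0 => /eqP.
Qed.

Lemma siZl a f h : S f -> S h -> B (a *: f) h = a * B f h.
Proof.
move=> Sf Sh; rewrite -[_ *: _]addr0 (siDZl SB)//; last exact: si0 SB.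
by rewrite si0l// addr0.
Qed.

Lemma siNl f h : S f -> S h -> B (- f) h = - B f h.
Proof. by move=> Sf Sh; rewrite -scaleN1r siZl// mulN1r. Qed.

Lemma siBl f g h : S f -> S g -> S h -> B (f - g) h = B f h - B g h.
Proof. by move=> Sf Sg Sh; rewrite siDl ?siNl//; exact: siN. Qed.

Lemma siDr f g h : S f -> S g -> S h -> B h (f + g) = B h f + B h g.
Proof.
by move=> Sf Sg Sh; rewrite ![B h _](siC SB) ?siDl//; exact: siD.
Qed.

Lemma siZr a f h : S f -> S h -> B h (a *: f) = a * B h f.
Proof.
by move=> Sf Sh; rewrite ![B h _](siC SB) ?siZl//; exact: siZ.
Qed.

Lemma siBr f g h : S f -> S g -> S h -> B h (f - g) = B h f - B h g.
Proof.
by move=> Sf Sg Sh; rewrite ![B h _](siC SB) ?siBl//; exact: siB.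
Qed.

Lemma si_suml (P : pred nat) (F : nat -> V) N h :
  (forall n, P n -> S (F n)) -> S h ->
  B (\sum_(0 <= n < N | P n) F n) h = \sum_(0 <= n < N | P n) B (F n) h.
Proof.
move=> SF Sh; rewrite !(big_mkcond P).
(* Extending by 0 off [P] turns the filtered sum into a plain one, on which induction on [N] is
   direct. *)
pose G n := if P n then F n else 0.
have SG n : S (G n) by rewrite /G; case: ifPn => [/SF//|_]; exact: si0 SB.
have -> : \sum_(0 <= n < N) (if P n then B (F n) h else 0) =
    \sum_(0 <= n < N) B (G n) h.
  by apply: eq_bigr => n _; rewrite /G; case: ifPn => // _; rewrite si0l.
rewrite -[X in B X h]/(\sum_(0 <= n < N) G n).
elim: N => [|N IH]; first by rewrite !big_geq// si0l.
by rewrite !big_nat_recr//= siDl ?IH//; exact: (@si_sum xpredT).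
Qed.

Lemma si_sqrD f g : S f -> S g ->
  B (f + g) (f + g) = B f f + 2 * B f g + B g g.
Proof.
move=> Sf Sg; have Sfg := siD Sf Sg.
by rewrite siDl// !siDr// (siC SB Sg Sf); ring.
Qed.

Lemma si_sqrZ a f : S f -> B (a *: f) (a *: f) = a ^+ 2 * B f f.
Proof.
by move=> Sf; rewrite siZl ?siZr//; [ring|exact: siZ].
Qed.

Lemma si_sqrB f g : S f -> S g ->
  B (f - g) (f - g) = B f f - 2 * B f g + B g g.
Proof.
move=> Sf Sg; have Sfg := siB Sf Sg.
by rewrite siBl// !siBr// (siC SB Sg Sf); ring.
Qed.

Lemma si_sqrDZ t f g : S f -> S g ->
  B (f + t *: g) (f + t *: g) = B f f + 2 * t * B f g + t ^+ 2 * B g g.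
Proof.
by move=> Sf Sg; rewrite si_sqrD ?si_sqrZ ?siZr//; [ring|exact: siZ].
Qed.

Lemma cauchy_schwarz f g : S f -> S g -> B f g ^+ 2 <= B f f * B g g.
Proof.
move=> Sf Sg; apply: discriminant_le; first exact: si_ge0 SB _ _.
move=> t; have := si_ge0 SB (siD Sf (siZ t Sg)).
by rewrite si_sqrDZ//; lra.
Qed.

(** The parallelogram law with the square of [f - g] dropped; it replaces the triangle inequality
    and avoids square roots. *)
Lemma si_sqrD_le f g : S f -> S g ->
  B (f + g) (f + g) <= 2 * (B f f + B g g).
Proof.
move=> Sf Sg; have := si_ge0 SB (siB Sf Sg).
by rewrite si_sqrB// si_sqrD//; lra.
Qed.

Lemma si_sqr0 f g : S f -> S g -> B g g = 0 -> B f g = 0.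
Proof.
move=> Sf Sg g0; have := cauchy_schwarz Sf Sg.
by rewrite g0 mulr0 real_exprn_even_le0//= => /eqP.
Qed.

Lemma si_cvg (u : nat -> V) f g : S f -> S g -> (forall n, S (u n)) ->
  B (u n - f) (u n - f) @[n --> \oo] --> 0 -> B (u n) g @[n --> \oo] --> B f g.
Proof.
move=> Sf Sg Su uf; apply/subr_cvg0.
apply/norm_cvg0P; under eq_fun => n do rewrite -siBl// -sqrtr_sqr.
apply: cvg0_sqrt.
apply: (@squeeze_cvgr _ _ _ _ (cst 0) (fun n => B (u n - f) (u n - f) * B g g)).
- by near=> n; rewrite sqr_ge0 cauchy_schwarz//; exact: siB.
- exact: cvg_cst.
- by rewrite -[0 in X in _ --> X](mul0r (B g g)); apply: cvgMl.
Unshelve. all: by end_near. Qed.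

Definition si_complete := forall u : nat -> V, (forall n, S (u n)) ->
  (forall e, 0 < e ->
    \forall m & n \near \oo, Num.sqrt (B (u m - u n) (u m - u n)) < e) ->
  exists2 f, S f & Num.sqrt (B (u n - f) (u n - f)) @[n --> \oo] --> (0 : R).

(** Completeness in the form used below: squares instead of norms, and an explicit bound for
    [m <= n] only, the other order following by a change of sign. *)
Lemma si_complete_bound (u : nat -> V) (r : nat -> R) : si_complete ->
  (forall n, S (u n)) -> r n @[n --> \oo] --> 0 ->
  (forall m n, (m <= n)%N -> B (u m - u n) (u m - u n) <= r m) ->
  exists2 f, S f & B (u n - f) (u n - f) @[n --> \oo] --> 0.
Proof.
move=> cS Su r0 ur.
have [|f Sf uf] := cS u Su; last first.
  exists f => //; apply: cvg0_sqrtK => // n.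
  exact/(si_ge0 SB)/siB.
move=> e e0; have : \forall n \near \oo, r n < e ^+ 2.
  by move/cvgr_lt : r0; apply; rewrite exprn_gt0.
move=> [N _ HN]; exists (`[N, +oo[%classic, `[N, +oo[%classic).
  by split; exists N => // n /=; rewrite in_itv/= andbT leEnat.
move=> [m n] /= []; rewrite !in_itv/= !andbT !leEnat => Nm Nn.
rewrite -(ger0_norm (ltW e0)) -sqrtr_sqr ltr_sqrt ?exprn_gt0//.
have [mn|nm] := leqP m n.
  by apply: le_lt_trans (ur _ _ mn) _; exact: HN.
rewrite -opprB -scaleN1r si_sqrZ; last exact: siB.
rewrite sqrrN expr1n mul1r.
by apply: le_lt_trans (ur _ _ (ltnW nm)) _; exact: HN.
Qed.

End semi_inner.

(** * Riesz representation and Fourier series *)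

Section riesz.
Context (R : realType) (V : lmodType R) (S : set V) (B : V -> V -> R).
Context (SB : semi_inner S B) (cS : si_complete S B).

(* The Riesz vector is the limit of a minimizing sequence of
   [F f = B f f - 2 phi f]; near-minimality gives, through the discriminant of
   [t |-> F (u n + t g)], that [u n] nearly represents [phi]. *)
Lemma riesz (phi : V -> R) (C : R) : 0 <= C ->
  (forall a f g, S f -> S g -> phi (a *: f + g) = a * phi f + phi g) ->
  (forall f, S f -> phi f ^+ 2 <= C * B f f) ->
  exists2 h, S h & forall g, S g -> B h g = phi g.
Proof.
move=> C0 phiL phiC; pose F f := B f f - 2 * phi f.
(* The square of [2 * phi f] is at most [4 * C * B f f], hence at most that of [B f f + C]. *)
have FC f : S f -> - C <= F f.
  move=> Sf; have := phiC _ Sf; have f0 := si_ge0 SB Sf.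
  rewrite /F => h; suff : 2 * phi f <= B f f + C by lra.
  apply: le_trans (ler_norm _) _; rewrite -(@ler_pXn2r _ 2) ?nnegrE//; last first.
    exact: addr_ge0.
  by rewrite real_normK ?num_real//; have := sqr_ge0 (B f f - C); lra.
have FinfP : has_inf (F @` S).
  split; first by exists (F 0), 0 => //; exact: si0 SB.
  by exists (- C) => _ [f Sf <-]; exact: FC.
pose I := inf (F @` S).
have IF f : S f -> I <= F f.
  by move=> Sf; apply: ge_inf; [case: FinfP|exists f].
have /choice[u uP] n : exists f, S f /\ F f < I + n.+1%:R^-1.
  have [|_ [f Sf <-] fI] := @inf_adherent _ (F @` S) n.+1%:R^-1 _ FinfP.
    by rewrite invr_gt0.
  by exists f.
have Su n : S (u n) by case: (uP n).
have uI n : F (u n) < I + n.+1%:R^-1 by case: (uP n).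
have phi_lin a f g : S f -> S g -> phi (f + a *: g) = phi f + a * phi g.
  by move=> Sf Sg; rewrite addrC phiL// addrC.
have harm0 (c : R) : c * n.+1%:R^-1 @[n --> \oo] --> 0.
  by rewrite -[0 in X in _ --> X](mulr0 c); apply: cvgMr; exact: cvg_harmonic.
(* At the midpoint of [u m] and [u n] the functional is the mean of [F (u m)] and [F (u n)] minus
   [B y y / 4], and it is at least [I]. Both values are within [m.+1%:R^-1] of [I], which gives the
   constant 4. *)
have [||m n mn|h Sh uh] := si_complete_bound SB (u := u)
    (r := fun n => 4 * n.+1%:R^-1) cS; [exact: Su|exact: harm0|..].
  pose y := u n - u m.
  have Sy : S y by exact: (siB SB).
  have Sm := siD SB (Su m) (siZ SB 2^-1 Sy).
  have -> : u m - u n = -1 *: y by rewrite scaleN1r opprB.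
  rewrite (si_sqrZ SB)//.
  have := IF _ Sm; rewrite /F (si_sqrDZ SB)// phi_lin//.
  have := uI m; have := uI n; rewrite /F.
  have -> : u n = u m + 1 *: y by rewrite scale1r addrC subrK.
  rewrite (si_sqrDZ SB)// phi_lin//.
  have : n.+1%:R^-1 <= m.+1%:R^-1 :> R by rewrite lef_pV2 ?posrE// ler_nat.
  set x := n.+1%:R^-1; set z := m.+1%:R^-1.
  by lra.
exists h => // g Sg.
have ug : B (u n) g @[n --> \oo] --> B h g by exact: (si_cvg SB).
rewrite -(cvg_lim (@Rhausdorff R) ug); apply: cvg_lim => //.
apply/subr_cvg0/norm_cvg0P; under eq_fun => n do rewrite -sqrtr_sqr.
apply: cvg0_sqrt; apply: (@squeeze_cvgr _ _ _ _ (cst 0)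
  (fun n => B g g * n.+1%:R^-1)); [|exact: cvg_cst|exact: harm0].
near=> n; rewrite sqr_ge0/= mulrC; apply: discriminant_le.
  exact: si_ge0 SB _ _.
move=> t; have := IF _ (siD SB (Su n) (siZ SB t Sg)).
have := uI n; rewrite /F (si_sqrDZ SB)// phi_lin//.
by set x := n.+1%:R^-1; lra.
Unshelve. all: by end_near. Qed.

End riesz.

Section fourier.
Context (R : realType) (V : lmodType R) (S : set V) (B : V -> V -> R).
Context (SB : semi_inner S B).
Context (P : pred nat) (e : nat -> V) (w : nat -> R).
Hypothesis eS : forall n, P n -> S (e n).
Hypothesis w0 : forall n, P n -> 0 < w n.
Hypothesis orth : forall m n, P m -> P n -> B (e m) (e n) = (m == n)%:R * w n.

(** The system is orthogonal with squared norms [w n], not orthonormal, so that the same functions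
    can be expanded in L2 with weight 1 and in [H] with weight [(sigma n)^-1]. *)
Definition fourier_sum N g : V :=
  \sum_(0 <= n < N | P n) (B g (e n) / w n) *: e n.

Definition energy N g : R :=
  \sum_(0 <= n < N | P n) B g (e n) ^+ 2 / w n.

Lemma fourier_sumS N g : S (fourier_sum N g).
Proof. by apply: (si_sum SB) => n Pn; apply: (siZ SB); exact: eS. Qed.

Lemma fourier_coef N g j : P j -> (j < N)%N ->
  B (fourier_sum N g) (e j) = B g (e j).
Proof.
move=> Pj jN; rewrite (si_suml SB); last 2 first.
- by move=> n Pn; apply: (siZ SB); exact: eS.
- exact: eS.
rewrite big_mkcond/= (bigD1_seq j) ?iota_uniq//=; last first.
  by rewrite mem_index_iota.
rewrite Pj big1 ?addr0 => [|n nj].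
  rewrite (siZl SB) ?orth//; [|exact: eS..].
  by rewrite eqxx mul1r divfK// gt_eqF// w0.
case: ifPn => // Pn; rewrite (siZl SB) ?orth//; [|exact: eS..].
by rewrite (negbTE nj) mul0r mulr0.
Qed.

Lemma fourier_ip N g h : S g ->
  S h -> B h (fourier_sum N g) = \sum_(0 <= n < N | P n) B g (e n) / w n * B h (e n).
Proof.
move=> Sg Sh; rewrite (siC SB)//; last exact: fourier_sumS.
rewrite (si_suml SB)//; last by move=> n Pn; apply: (siZ SB); exact: eS.
by apply: eq_bigr => n Pn; rewrite (siZl SB) 1?(siC SB Sh)//; exact: eS.
Qed.

Lemma fourier_ipE N g : S g -> B g (fourier_sum N g) = energy N g.
Proof.
by move=> Sg; rewrite fourier_ip//; apply: eq_bigr => n Pn; rewrite mulrAC.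
Qed.

Lemma fourier_sqr N g : S g ->
  B (fourier_sum N g) (fourier_sum N g) = energy N g.
Proof.
move=> Sg; rewrite fourier_ip//; last exact: fourier_sumS.
rewrite /energy big_nat_cond [RHS]big_nat_cond.
apply: eq_bigr => n /andP[/andP[_ nN] Pn].
by rewrite fourier_coef// mulrAC.
Qed.

Lemma fourier_residual N g : S g ->
  B (g - fourier_sum N g) (g - fourier_sum N g) = B g g - energy N g.
Proof.
move=> Sg; have SN := fourier_sumS N g.
by rewrite (si_sqrB SB)// fourier_sqr// fourier_ipE//; ring.
Qed.

Lemma energy_nondecreasing g : nondecreasing_seq (energy ^~ g).
Proof.
apply/nondecreasing_seqP => n; rewrite /energy !(big_mkcond P)/=.
by rewrite big_nat_recr//= lerDl; case: ifPn => // Pn;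
  rewrite divr_ge0 ?sqr_ge0// ltW// w0.
Qed.

Lemma bessel N g : S g -> energy N g <= B g g.
Proof.
move=> Sg; rewrite -subr_ge0 -fourier_residual//.
exact/(si_ge0 SB)/(siB SB)/fourier_sumS.
Qed.

Lemma is_cvg_energy g : S g -> cvgn (energy ^~ g).
Proof.
move=> Sg; apply: nondecreasing_is_cvgn; first exact: energy_nondecreasing.
by exists (B g g) => _ [n _ <-]; exact: bessel.
Qed.

(** Below [M] both partial sums have the coefficients of [g], so their inner product is the smaller
    energy. *)
Lemma fourier_sum_cauchy M N g : S g -> (M <= N)%N ->
  B (fourier_sum M g - fourier_sum N g) (fourier_sum M g - fourier_sum N g) =
  energy N g - energy M g.
Proof.
move=> Sg MN; have SN := fourier_sumS N g; have SM := fourier_sumS M g.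
have BMN : B (fourier_sum M g) (fourier_sum N g) = energy M g.
  rewrite (siC SB)// fourier_ip//.
  rewrite /energy big_nat_cond [RHS]big_nat_cond.
  apply: eq_bigr => n /andP[/andP[_ nM] Pn].
  by rewrite fourier_coef ?(leq_trans nM)// mulrAC.
by rewrite (si_sqrB SB)// !fourier_sqr// BMN; ring.
Qed.

Lemma parseval g : S g ->
  B (g - fourier_sum N g) (g - fourier_sum N g) @[N --> \oo] --> 0 ->
  energy N g @[N --> \oo] --> B g g.
Proof.
move=> Sg h; have -> : energy ^~ g = fun N =>
    B g g - B (g - fourier_sum N g) (g - fourier_sum N g).
  by apply/funext => N; rewrite fourier_residual//; ring.
by rewrite -[X in _ --> X]subr0; apply: cvgB => //; exact: cvg_cst.
Qed.

Lemma fourier_cvg : si_complete S B ->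
  (forall f, S f -> (forall n, P n -> B f (e n) = 0) -> B f f = 0) ->
  forall g, S g ->
  B (g - fourier_sum N g) (g - fourier_sum N g) @[N --> \oo] --> 0.
Proof.
move=> cS total g Sg; pose l := limn (energy ^~ g).
have El : energy N g @[N --> \oo] --> l by exact: is_cvg_energy.
have [||M N MN|f Sf uf] := si_complete_bound SB (u := fourier_sum ^~ g)
    (r := fun N => l - energy N g) cS.
- by move=> N; exact: fourier_sumS.
- by rewrite -(subrr l); apply: cvgB => //; exact: cvg_cst.
- rewrite fourier_sum_cauchy// lerD2r.
  apply: nondecreasing_cvgn_le; [exact: energy_nondecreasing|].
  exact: is_cvg_energy.
have Sgf : S (g - f) by exact: (siB SB).
(* From [N = j.+1] on, the [j]-th coefficient of the partial sum is that of [g], so the limit [f]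
   has the same coefficients as [g]. *)
have gf0 : B (g - f) (g - f) = 0.
  apply: total => // j Pj; have Sej := eS Pj.
  have := si_cvg SB Sf Sej (fourier_sumS ^~ g) uf.
  rewrite (siBl SB)// => h; apply/eqP; rewrite subr_eq0; apply/eqP.
  rewrite -(cvg_lim (@Rhausdorff R) h); apply/esym/cvg_lim => //.
  apply: cvg_near_cst; exists j.+1 => // N /= jN.
  by rewrite fourier_coef.
(* The limit [f] may differ from [g] by a null vector; [si_sqrD_le] absorbs it at the price of a
   factor 2. *)
apply: (@squeeze_cvgr _ _ _ _ (cst 0)
  (fun n => 2 * B (fourier_sum n g - f) (fourier_sum n g - f))).
- near=> n; have Sn := fourier_sumS n g.
  rewrite (si_ge0 SB (siB SB Sg Sn))/=.
  have -> : g - fourier_sum n g = (g - f) + - (fourier_sum n g - f).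
    by rewrite opprB addrA subrK.
  apply: le_trans (si_sqrD_le SB _ _) _ => //; first exact/(siN SB)/(siB SB).
  rewrite gf0 add0r -scaleN1r (si_sqrZ SB) ?sqrrN ?expr1n ?mul1r//.
  exact: (siB SB).
- exact: cvg_cst.
- by rewrite -[0 in X in _ --> X](mulr0 2); apply: cvgMr.
Unshelve. all: by end_near. Qed.

(** Density replaces completeness of [S]. Subtracting the partial sum [y] of a nearby [f] leaves the
    residual of [g] unchanged, since [y] is its own partial sum; the residual is then at most the
    square of [g - y]. Two errors below [r / 4], doubled by [si_sqrD_le], stay below [r]. *)
Lemma fourier_cvg_closure (D : set V) g : D `<=` S -> S g ->
  (forall f, D f ->
    B (f - fourier_sum N f) (f - fourier_sum N f) @[N --> \oo] --> 0) ->
  (forall r, 0 < r -> exists2 f, D f & B (g - f) (g - f) < r) ->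
  B (g - fourier_sum N g) (g - fourier_sum N g) @[N --> \oo] --> 0.
Proof.
move=> DS Sg cD approx; apply/cvgrPdist_lt => r r0.
have r4 : 0 < r / 4 by rewrite divr_gt0.
have [f Df gf] := approx _ r4; have Sf := DS _ Df.
have /cvgrPdist_lt/(_ _ r4) := cD _ Df; apply: filterS => N.
rewrite !sub0r !normrN; set y := fourier_sum N f => fN.
have Sy : S y := fourier_sumS N f; have SN := fourier_sumS N g.
rewrite !ger0_norm in fN *; try exact/(si_ge0 SB)/(siB SB).
have Sfy : S (f - y) by exact: (siB SB).
have Sgf : S (g - f) by exact: (siB SB).
have Sgy : S (g - y) by exact: (siB SB).
have -> : g - fourier_sum N g = (g - y) - fourier_sum N (g - y).
  have -> : fourier_sum N (g - y) = fourier_sum N g - y.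
    rewrite /y /fourier_sum -sumrB [LHS]big_nat_cond [RHS]big_nat_cond.
    apply: eq_bigr => n /andP[/andP[_ nN] Pn]; rewrite -scalerBl.
    rewrite (siBl SB)//; last exact: eS.
    by rewrite -/(fourier_sum N f) fourier_coef// mulrBl.
  by rewrite opprB addrA subrK.
rewrite fourier_residual//.
have gy : B (g - y) (g - y) < r.
  have -> : g - y = (g - f) + (f - y) by rewrite addrA subrK.
  by apply: le_lt_trans (si_sqrD_le SB _ _) _ => //; lra.
apply: le_lt_trans gy; rewrite gerBl /energy sumr_ge0// => n Pn.
by rewrite divr_ge0 ?sqr_ge0// ltW// w0.
Qed.

End fourier.

(** * Filtered sums and L2 *)

Lemma esum_cvg (R : realType) (P : pred nat) (f : nat -> R) (l : R) :
  (forall n, P n -> 0 <= f n) ->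
  \sum_(0 <= n < N | P n) f n @[N --> \oo] --> l ->
  (\esum_(n in [set n | P n]) (f n)%:E = l%:E)%E.
Proof.
move=> f0 fl; rewrite -nneseries_esum//.
apply/cvg_lim => //.
rewrite (_ : (fun N => _) = EFin \o (fun N => \sum_(0 <= n < N | P n) f n)).
  exact: cvg_comp fl _.
by apply/funext => N; rewrite /= sumEFin.
Qed.

(* Splitting at [N0], the filtered sum is at most [lambda^2 K] plus a tail of
   the unfiltered one. *)
Lemma ridge_filter_cvg0 (R : realType) (P : pred nat) (s b : nat -> R)
    (F : R -> R) :
  (forall n, P n -> 0 < s n) -> (forall n, P n -> 0 <= b n) ->
  cvgn (fun N => \sum_(0 <= n < N | P n) b n) ->
  (forall lambda, 0 < lambda ->
    \sum_(0 <= n < N | P n) (lambda ^+ 2 / (s n + lambda) ^+ 2 * b n)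
      @[N --> \oo] --> F lambda) ->
  F lambda @[lambda --> 0^'+] --> 0.
Proof.
move=> s0 b0 bl cF; pose E N := \sum_(0 <= n < N | P n) b n.
have nE : nondecreasing_seq E.
  apply/nondecreasing_seqP => n; rewrite /E !(big_mkcond P)/=.
  by rewrite big_nat_recr//= lerDl; case: ifPn => // /b0.
apply/cvgrPdist_lt => e e0; have e2 : 0 < e / 2 by rewrite divr_gt0.
have /cvgrPdist_lt/(_ _ e2)[N0 _ /(_ N0 (leqnn N0))/= EN0] : E N @[N --> \oo] --> limn E.
  exact: bl.
pose K := \sum_(0 <= n < N0 | P n) b n / s n ^+ 2.
have ge0 lambda n : 0 < lambda -> P n ->
    0 <= lambda ^+ 2 / (s n + lambda) ^+ 2 * b n.
  by move=> l0 Pn; rewrite mulr_ge0 ?b0// divr_ge0// sqr_ge0.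
have F0 lambda : 0 < lambda -> 0 <= F lambda.
  move=> l0; apply: cvgr_to_ge (cF _ l0) _.
  by near=> N; rewrite sumr_ge0// => n; exact: ge0.
(* Below [N0] the factor is at most [lambda ^+ 2 / s n ^+ 2], from [N0] on it is at most 1. *)
have FK lambda : 0 < lambda -> F lambda <= lambda ^+ 2 * K + (limn E - E N0).
  move=> l0; apply: cvgr_to_le (cF _ l0) _.
  exists N0 => // N /= N0N; rewrite (@big_cat_nat _ _ _ N0)//= lerD//.
    rewrite /K mulr_sumr ler_sum// => n Pn; rewrite [leRHS]mulrA [leRHS]mulrAC.
    rewrite ler_wpM2r ?b0// ler_wpM2l ?sqr_ge0//.
    rewrite lef_pV2 ?posrE ?exprn_gt0 ?addr_gt0 ?s0//.
    by rewrite ler_pXn2r ?nnegrE ?addr_ge0 ?lerDl ?ltW ?s0.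
  rewrite lerBrDl; apply: (@le_trans _ _ (E N)); last first.
    exact: nondecreasing_cvgn_le.
  rewrite /E (@big_cat_nat _ _ _ N0 0 N)//= lerD2l ler_sum// => n Pn.
  rewrite ler_piMl ?b0// ler_pdivrMr ?exprn_gt0 ?addr_gt0 ?s0// mul1r.
  by rewrite ler_pXn2r ?nnegrE ?addr_ge0 ?lerDr ?ltW ?s0.
have : lambda ^+ 2 * K @[lambda --> (0 : R)^'+] --> 0.
  rewrite -[X in _ --> X](mul0r K); apply: cvgMl.
  apply: cvg_at_right_filter; rewrite -[X in _ --> X](expr0n R 2).
  exact: exprn_continuous.
move=> /cvgrPdist_lt/(_ _ e2) lK; near=> lambda.
have l0 : 0 < lambda by [].
rewrite sub0r normrN ger0_norm ?F0//; apply: le_lt_trans (FK _ l0) _.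
rewrite [ltRHS]splitr ltrD//.
  apply: le_lt_trans (ler_norm _) _; rewrite -normrN -sub0r.
  by near: lambda.
by apply: le_lt_trans (ler_norm _) _.
Unshelve. all: by end_near. Qed.

(** * Square integrable functions as a semi-inner product space *)

Section L2_theory.
Context d (T : measurableType d) (R : realType) (mu : {measure set T -> \bar R}).
Implicit Types f g : T -> R.

Lemma L2_measurable f : L2 mu f -> measurable_fun setT f.
Proof. by move=> /andP[+ _]; rewrite inE. Qed.

Lemma L2_integrable_sqr f : L2 mu f -> mu.-integrable setT (EFin \o (fun x => f x ^+ 2)).
Proof. exact: Lfun2_integrable_sqr. Qed.

Lemma L2_integrableM f g : L2 mu f -> L2 mu g ->
  mu.-integrable setT (EFin \o (f \* g)).
Proof. by move=> Lf Lg; apply/Lfun1_integrable/Lfun2_mul_Lfun1. Qed.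

Lemma L2_of_sqr f : measurable_fun setT f ->
  (\int[mu]_x (f x ^+ 2)%:E < +oo)%E -> L2 mu f.
Proof.
move=> mf fi; apply/andP; split; first by rewrite inE.
rewrite inE/= /finite_norm unlock/= poweR_lty//.
by under eq_integral => x _ do rewrite powR_mulrn// -normrX ger0_norm ?sqr_ge0//.
Qed.

Lemma L2_integral_sqr f : L2 mu f ->
  (\int[mu]_x (f x ^+ 2)%:E = (L2ip mu f f)%:E)%E.
Proof.
move=> Lf; rewrite /L2ip /Rintegral fineK; last first.
  exact/integrable_fin_num/(L2_integrableM Lf Lf).
by apply: eq_integral.
Qed.

Lemma L2norm_ip f : L2 mu f -> L2norm mu f = (Num.sqrt (L2ip mu f f))%:E.
Proof.
move=> Lf; rewrite /L2norm unlock/=.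
under eq_integral => x _ do rewrite powR_mulrn// -normrX ger0_norm ?sqr_ge0//.
rewrite L2_integral_sqr//= powR12_sqrt// Rintegral_ge0// => x _.
by rewrite -expr2 sqr_ge0.
Qed.

Lemma L2_semi_inner : semi_inner (L2 mu : set (T -> R)) (L2ip mu).
Proof.
have [L0 LDZ] := @Lfun_submod_closed _ _ _ mu 2%:E (lee1n 2).
split; [exact: L0|by move=> a f g Lf Lg; exact: LDZ|..].
- by move=> f g _ _; apply: eq_Rintegral => x _; rewrite mulrC.
- move=> a f g h Lf Lg Lh; rewrite /L2ip.
  have Ifh := L2_integrableM Lf Lh; have Igh := L2_integrableM Lg Lh.
  rewrite -RintegralZl// -RintegralD//; last first.
    exact: (@integrableZl _ _ _ mu setT measurableT a _ Ifh).
  by apply: eq_Rintegral => x _; rewrite /= mulrDl mulrA.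
- by move=> f Lf; apply: Rintegral_ge0 => x _; rewrite -expr2 sqr_ge0.
Qed.

Lemma L2ip_ae0 f : L2 mu f -> {ae mu, forall x, f x = 0} -> L2ip mu f f = 0.
Proof.
move=> Lf f0; rewrite /L2ip /Rintegral (ae_eq_integral (cst 0%E))//.
- by rewrite integral0.
- exact: measurable_int (L2_integrableM Lf Lf).
- by apply: filterS f0 => x /= -> _; rewrite mul0r.
Qed.

Lemma L2ip_eq0_ae f : L2 mu f -> L2ip mu f f = 0 -> {ae mu, forall x, f x = 0}.
Proof.
move=> Lf f0; have := L2_integral_sqr Lf; rewrite f0 => h.
pose f2 : T -> \bar R := EFin \o (fun x => f x ^+ 2).
have mf : measurable_fun setT f2.
  exact: measurable_int (L2_integrable_sqr Lf).
have /(ae_eq_integral_abs mu measurableT mf) :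
    (\int[mu]_x `|f2 x| = 0)%E.
  by apply: etrans h; apply: eq_integral => x _; rewrite /f2/= ger0_norm ?sqr_ge0.
by apply: filterS => x /(_ I) /= [] /eqP; rewrite sqrf_eq0 => /eqP.
Qed.

Lemma L2_le f g :
  measurable_fun setT f -> (forall x, `|f x| <= `|g x|) -> L2 mu g -> L2 mu f.
Proof.
move=> mf fg Lg; apply: L2_of_sqr => //.
have /integrable_lty : mu.-integrable setT (EFin \o (fun x => g x ^+ 2)).
  exact: L2_integrable_sqr.
move=> /(_ measurableT); apply: le_lt_trans; apply: ge0_le_integral => //.
- by move=> x _; rewrite lee_fin sqr_ge0.
- by apply/measurable_EFinP; exact: measurable_funX.
- by apply/measurable_EFinP; apply: measurable_funX; exact: L2_measurable Lg.
- move=> x _; rewrite /= lee_fin -[f x ^+ 2]real_normK ?num_real//.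
  by rewrite -[g x ^+ 2]real_normK ?num_real// ler_pXn2r ?nnegrE.
Qed.

End L2_theory.

Lemma L2_cst d (T : measurableType d) (R : realType) (mu : probability T R)
    (c : R) : L2 mu (cst c).
Proof.
apply: L2_of_sqr => //; rewrite (eq_integral (cst (c ^+ 2)%:E)) => [|//].
by rewrite integral_cst//= probability_setT mule1 ltry.
Qed.

(** * Marginals and conditional expectation *)

Section L2_marginal.
Context d (T : measurableType d) (R : realType) (nu : probability (T * T)%type R).
Implicit Types f g : T -> R.

Lemma ge0_integral_marginal1 f : measurable_fun setT f -> (forall x, 0 <= f x) ->
  (\int[marginal1 nu]_x (f x)%:E = \int[nu]_z (f z.1)%:E)%E.
Proof.
move=> mf f0; have := @ge0_integral_pushforward _ _ _ _ _ _
  (@measurable_fst _ _ T T) nu setT (EFin \o f) measurableT.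
rewrite preimage_setT => <- //; first exact/measurable_EFinP.
by move=> x _; rewrite lee_fin.
Qed.

Lemma integral_marginal1 (U : set T) f : measurable U ->
  measurable_fun setT f -> nu.-integrable setT (EFin \o (f \o fst)) ->
  (\int[marginal1 nu]_(x in U) (f x)%:E = \int[nu]_(z in fst @^-1` U) (f z.1)%:E)%E.
Proof.
move=> mU mf fi.
have mfst : measurable (fst @^-1` U : set (T * T)).
  by rewrite -[X in measurable X]setTI; exact: measurable_fst.
have mEf : measurable_fun [set: T] (EFin \o f) by exact/measurable_EFinP.
have := @integral_pushforward _ _ _ _ _ _
  (@measurable_fst _ _ T T) nu U (EFin \o f) mEf.
move=> <- //.
exact: (integrableS measurableT mfst (@subsetT _ _) fi).
Qed.

Lemma L2_fst f : L2 (marginal1 nu) f -> L2 nu (f \o fst).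
Proof.
move=> Lf; have mf := L2_measurable Lf; apply: L2_of_sqr.
  exact: measurableT_comp mf measurable_fst.
rewrite -(@ge0_integral_marginal1 (fun x => f x ^+ 2)) => [| |x]; last 2 first.
- exact: measurable_funX.
- exact: sqr_ge0.
by have /integrable_lty := L2_integrable_sqr Lf; exact.
Qed.

Lemma L2ip_fst f g : L2 (marginal1 nu) f -> L2 (marginal1 nu) g ->
  L2ip nu (f \o fst) (g \o fst) = L2ip (marginal1 nu) f g.
Proof.
move=> Lf Lg; rewrite /L2ip /Rintegral.
rewrite -(@integral_marginal1 setT (f \* g))//.
- exact: measurable_funM (L2_measurable Lf) (L2_measurable Lg).
- exact: (L2_integrableM (L2_fst Lf) (L2_fst Lg)).
Qed.

Section condexp.
Import HBSimple HBNNSimple.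
Context (A m : T -> R).
Hypotheses (LA : L2 nu (A \o snd)) (Lm : L2 (marginal1 nu) m).
Hypothesis cm : is_condexp nu A m.

(** The regression residual. Its orthogonality to functions of the first coordinate climbs from
    indicators, where it is the definition of conditional expectation, to simple, nonnegative and
    general functions. *)
Let D : T * T -> R := (A \o snd) - (m \o fst).

Let LD : L2 nu D.
Proof. by apply: (siB (L2_semi_inner nu)) => //; exact: L2_fst. Qed.

Let L2_1 (f : T * T -> R) : L2 nu f -> nu.-integrable setT (EFin \o f).
Proof.
move=> Lf; have := L2_integrableM Lf (L2_cst nu 1); rewrite (_ : f \* cst 1 = f)//.
by apply/funext => z; rewrite /= mulr1.
Qed.

Let L2_indic U : measurable U -> L2 nu (\1_U \o fst).
Proof.
move=> mU; apply: (L2_le _ _ (L2_cst nu 1)).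
  by apply: measurableT_comp; [exact: measurable_indic|exact: measurable_fst].
by move=> z; rewrite /= indicE; case: (_ \in _); rewrite ?normr0// normr1.
Qed.

Let indic_orth U : measurable U -> L2ip nu (\1_U \o fst) D = 0.
Proof.
move=> mU; have mfst : measurable (fst @^-1` U : set (T * T)).
  by rewrite -[X in measurable X]setTI; exact: measurable_fst.
have -> : L2ip nu (\1_U \o fst) D = \int[nu]_(z in fst @^-1` U) D z.
  rewrite [RHS]Rintegral_mkcond; apply: eq_Rintegral => z _.
  rewrite /= indicE patchE (_ : (z \in fst @^-1` U) = (z.1 \in U))//.
  by case: (_ \in _); rewrite ?mul1r ?mul0r.
rewrite RintegralB//; last 2 first.
- by apply: (integrableS measurableT) => //; exact: L2_1 LA.
- by apply: (integrableS measurableT) => //; exact/L2_1/L2_fst.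
rewrite /Rintegral -integral_marginal1//; last 2 first.
- exact: L2_measurable Lm.
- exact/L2_1/L2_fst.
have [_ ->//] := cm.
rewrite (_ : U `*` setT = fst @^-1` U) ?subrr//.
by apply/seteqP; split => z; [case|].
Qed.

(** Shaped after the decomposition of a simple function: [s] lists its values and [U y] is the level
    set of [y]. *)
Let simple_orth (s : seq R) (U : R -> set T) : (forall y, measurable (U y)) ->
  L2 nu (\sum_(y <- s) y *: (\1_(U y) \o fst)) /\
  L2ip nu (\sum_(y <- s) y *: (\1_(U y) \o fst)) D = 0.
Proof.
move=> mU; have L2nu := L2_semi_inner nu; elim: s => [|y s [Ls s0]].
  by rewrite big_nil; split; [exact: si0 L2nu|exact: (si0l L2nu)].
rewrite big_cons; split; first exact: (siDZ L2nu y (L2_indic (mU y)) Ls).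
by rewrite (siDZl L2nu y (L2_indic (mU y)) Ls LD) indic_orth// s0 mulr0 addr0.
Qed.

Let ge0_orth g : L2 (marginal1 nu) g -> (forall x, 0 <= g x) ->
  L2ip nu (g \o fst) D = 0.
Proof.
move=> Lg g0; have mg := L2_measurable Lg.
have mEg : measurable_fun [set: T] (EFin \o g) by exact/measurable_EFinP.
pose h := nnsfun_approx measurableT mEg.
have gh x : h n x @[n --> \oo] --> g x.
  have g0' y : [set: T] y -> (0 <= (EFin \o g) y)%E by rewrite lee_fin.
  exact: fine_cvg (cvg_nnsfun_approx measurableT mEg g0' I).
have hg n x : h n x <= g x.
  rewrite -(cvg_lim (@Rhausdorff R) (@gh x)); apply: nondecreasing_cvgn_le.
    by move=> i j ij; exact/lefP/(nd_nnsfun_approx measurableT mEg ij).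
  by apply/cvg_ex; exists (g x).
have h0 n x : 0 <= h n x by [].
have Lhg n : L2 (marginal1 nu) (h n).
  by apply: (L2_le _ _ Lg) => // x; rewrite !ger0_norm.
have hD n : L2ip nu (h n \o fst) D = 0.
  have mU y : measurable (h n @^-1` [set y]).
    by rewrite -[X in measurable X]setTI; apply: (L2_measurable (Lhg n)).
  have [_ <-] := simple_orth (finmap.enum_fset (fset_set (range (h n)))) mU.
  congr L2ip; apply/funext => z /=.
  rewrite (fimfunE (h n) z.1) fsbig_finite//= fct_sumE.
  by apply: eq_bigr.
have mF n : measurable_fun [set: T * T] (EFin \o ((h n \o fst) \* D)).
  exact: measurable_int (L2_integrableM (L2_fst (Lhg n)) LD).
have mG : measurable_fun [set: T * T] (EFin \o ((g \o fst) \* D)).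
  exact: measurable_int (L2_integrableM (L2_fst Lg) LD).
(* The dominating function is [|g D|], integrable as a product of two L2 functions; it dominates
   because [0 <= h n <= g]. *)
have [|||_ _] := dominated_convergence measurableT mF mG
  (g := EFin \o (fun z => `|((g \o fst) \* D) z|)) (mu := nu).
- apply: aeW => z _; apply: cvg_EFin; first by near=> n.
  exact: cvgMl (gh z.1).
- exact: integrable_norm (L2_integrableM (L2_fst Lg) LD).
- apply: aeW => z n _; rewrite /= lee_fin !normrM ler_wpM2r//.
  by rewrite !ger0_norm.
- move=> /= cvgI; rewrite /L2ip /Rintegral.
  suff -> : (\int[nu]_x ((g \o fst) x * D x)%:E = 0)%E by [].
  have := cvg_lim (@ereal_hausdorff R) cvgI => <-.
  apply/cvg_lim => //; apply: cvg_near_cst; near=> n.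
  rewrite -[LHS]fineK; last first.
    exact: integrable_fin_num (L2_integrableM (L2_fst (Lhg n)) LD).
  by congr EFin; exact: hD.
Unshelve. all: by end_near. Qed.

Lemma condexp_ip g : L2 (marginal1 nu) g ->
  L2ip nu (A \o snd) (g \o fst) = L2ip (marginal1 nu) m g.
Proof.
move=> Lg; have L2nu := L2_semi_inner nu.
have L2mu := L2_semi_inner (marginal1 nu).
have Lng : L2 (marginal1 nu) (fun x => `|g x|).
  apply: (L2_le _ _ Lg) => [|x]; last by rewrite normr_id.
  by apply: measurableT_comp => //; exact: L2_measurable Lg.
(* Twice the positive and negative parts of [g]: both are nonnegative, and their difference is
   [2 g]. *)
pose p : T -> R := (fun x => `|g x|) + g; pose q : T -> R := (fun x => `|g x|) - g.
have Lp : L2 (marginal1 nu) p by exact: (siD L2mu).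
have Lq : L2 (marginal1 nu) q by exact: (siB L2mu).
have gpq : 2 *: (g \o fst) = (p \o fst) - (q \o fst) :> (T * T -> R).
  by apply/funext => z; rewrite /p /q !fctE/= /GRing.scale/=; ring.
have /eqP : L2ip nu D (2 *: (g \o fst)) = 0.
  rewrite gpq (siC L2nu)//; last by apply: (siB L2nu); exact: L2_fst.
  rewrite (siBl L2nu)//; [|exact: L2_fst..].
  rewrite !ge0_orth ?subrr//.
  - by move=> x; rewrite /q !fctE/= subr_ge0 ler_norm.
  - move=> x; rewrite -[p x]/(`|g x| + g x).
    by have := ler_norm (- g x); rewrite normrN; lra.
rewrite (siZr L2nu)//; last exact: L2_fst.
rewrite mulf_eq0 pnatr_eq0/= (siBl L2nu)//; [|exact: L2_fst..].
by rewrite subr_eq0 => /eqP ->; rewrite L2ip_fst.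
Qed.

End condexp.
End L2_marginal.

(** * Reproducing kernel Hilbert spaces *)

Section rkhs_facts.
Context (R : realType) (T : Type) (k : T -> T -> R) (H : set (T -> R))
  (ip : (T -> R) -> (T -> R) -> R) (Hr : is_rkhs k H ip).

Lemma rkhs_semi_inner : semi_inner (H : set (T -> R)) ip.
Proof.
have H0 := rkhs_zero Hr.
(* [rkhs_ip_gt0] says nothing about the zero function, whose square is obtained from linearity. *)
have ip0 f : H f -> ip (cst 0) f = 0.
  move=> Hf; have := rkhs_ip_linear Hr 1 H0 H0 Hf.
  rewrite (_ : (1 \*o cst 0 \+ cst 0)%R = cst 0 :> (T -> R)); first by lra.
  by apply/funext => x /=; rewrite mulr0 addr0.
split => //.
- exact: rkhs_linear Hr.
- exact: rkhs_ip_sym Hr.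
- exact: rkhs_ip_linear Hr.
- move=> f Hf; have [->|f0] := pselect (f = cst 0); first by rewrite ip0.
  exact/ltW/(rkhs_ip_gt0 Hr).
Qed.

Lemma rkhs_si_complete : si_complete (H : set (T -> R)) ip.
Proof. exact: rkhs_complete Hr. Qed.

Lemma rkhs_ip_kernel x y : ip (k x) (k y) = k x y.
Proof. by rewrite -(rkhs_reproducing Hr)//; exact: rkhs_kernel Hr _. Qed.

Lemma rkhs_sqr_le f x : H f -> f x ^+ 2 <= ip f f * k x x.
Proof.
move=> Hf; rewrite {1}(rkhs_reproducing Hr x Hf) -rkhs_ip_kernel.
by apply: (cauchy_schwarz rkhs_semi_inner) => //; exact: rkhs_kernel Hr _.
Qed.

(** The last factor is the squared distance of [k x] and [k y] in [H]; continuity of [k] thus passes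
    to every element of [H]. *)
Lemma rkhs_dist_le f x y : H f ->
  (f x - f y) ^+ 2 <= ip f f * (k x x - 2 * k x y + k y y).
Proof.
move=> Hf; have HI := rkhs_semi_inner.
have Hx := rkhs_kernel Hr x; have Hy := rkhs_kernel Hr y.
rewrite (rkhs_reproducing Hr x Hf) (rkhs_reproducing Hr y Hf) -(siBr HI)//.
apply: le_trans (cauchy_schwarz HI Hf (siB HI Hx Hy)) _.
by rewrite (si_sqrB HI)// !rkhs_ip_kernel.
Qed.

Lemma rkhs_hnorm_sqr f : H f -> hnorm ip f ^+ 2 = ip f f.
Proof. by move=> Hf; rewrite sqr_sqrtr// (si_ge0 rkhs_semi_inner). Qed.

End rkhs_facts.

Lemma diagonal_continuous (R : realType) (T : topologicalType) (k : T -> T -> R) :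
  continuous (fun z : T * T => k z.1 z.2) -> continuous (fun x => k x x).
Proof.
move=> ck y; suff: k x x @[x --> y] --> k y y by [].
by apply: continuous2_cvg; [exact: (ck (y, y))|exact: cvg_id|exact: cvg_id].
Qed.

Lemma rkhs_continuous (R : realType) (T : topologicalType) (k : T -> T -> R)
    (H : set (T -> R)) (ip : (T -> R) -> (T -> R) -> R) (f : T -> R) :
  is_rkhs k H ip -> continuous (fun z : T * T => k z.1 z.2) -> H f ->
  continuous f.
Proof.
move=> Hr ck Hf y; apply/subr_cvg0/norm_cvg0P.
under eq_fun => x do rewrite -sqrtr_sqr.
apply: cvg0_sqrt.
apply: (@squeeze_cvgr _ _ _ _ (cst 0)
  (fun x => ip f f * (k x x - 2 * k x y + k y y))).
- by near=> x; rewrite sqr_ge0 (rkhs_dist_le Hr).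
- exact: cvg_cst.
- have kxx : k x x @[x --> y] --> k y y by exact: diagonal_continuous ck y.
  have kxy : k x y @[x --> y] --> k y y.
    by apply: continuous2_cvg; [exact: (ck (y, y))|exact: cvg_id|exact: cvg_cst].
  rewrite [X in _ --> X](_ : 0 = ip f f * (k y y - 2 * k y y + k y y)); last by ring.
  apply: cvgMr; apply: cvgD; last exact: cvg_cst.
  by apply: cvgB => //; apply: cvgMr.
Unshelve. all: by end_near. Qed.

(** * Continuity and almost everywhere equality on the domain *)

Section domain_facts.
Context (R : realType) (d : nat) (X : set 'rV[R]_d) (X0 : X !=set0).

Lemma domain_continuous_measurable (f : domain X0 -> R) :
  continuous f -> measurable_fun setT f.
Proof.
move=> /continuousP cf; apply: (measurability _ (RGenOpens.measurableE R)).
move=> _ [_ [a [b ->] <-]]; rewrite setTI; apply: sub_sigma_algebra.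
exact/cf/interval_open.
Qed.

Lemma enorm_continuous : continuous (@enorm R d X X0).
Proof.
have cval (i : 'I_d) : continuous (fun y : domain X0 => (\val y) 0 i).
  move=> y; apply: (@continuous_comp _ _ _ (fun y : domain X0 => \val y)
    (fun M : 'rV[R]_d => M 0 i)); first exact: initial_continuous.
  exact: coord_continuous.
have csum : continuous (fun y : domain X0 => \sum_i (\val y) 0 i ^+ 2).
  move=> y; have yF : Filter (nbhs y) := nbhs_filter y.
  apply: cvg_big => [|i _]; first exact: add_continuous.
  exact: cvgM (cval i y) (cval i y).
move=> x; apply: (@continuous_comp _ _ _
  (fun y : domain X0 => \sum_i (\val y) 0 i ^+ 2) Num.sqrt); first exact: csum.
exact: sqrt_continuous.
Qed.

(** The set where two continuous functions differ is open, so it has positive mass unless it is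
    empty. *)
Lemma domain_ae_eq (mu : {measure set (domain X0) -> \bar R})
    (f g : domain X0 -> R) :
  (forall U : set (domain X0), open U -> U !=set0 -> (0 < mu U)%E) ->
  continuous f -> continuous g -> {ae mu, forall x, f x = g x} -> f = g.
Proof.
move=> pos cf cg fg; apply: contrapT => nfg.
pose U : set (domain X0) := (f \- g) @^-1` [set~ 0].
have oU : open U.
  have /continuousP : continuous (f \- g).
    by move=> x; exact: cvgB (cf x) (cg x).
  apply; rewrite openC; apply: closed_eq.
have Un0 : U !=set0.
  apply: contrapT => nU; apply: nfg; apply/funext => x; apply: contrapT => fgx.
  by apply: nU; exists x => /= /eqP; rewrite subr_eq0 => /eqP.
have mU : measurable U by exact: sub_sigma_algebra.
have [N [mN N0 NU]] := fg.
have : (mu U <= mu N)%E.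
  apply: le_measure; rewrite ?inE// => x Ux; apply: NU => /= fgx.
  by apply: Ux; rewrite /= fgx subrr.
by rewrite N0 leNgt pos.
Qed.

End domain_facts.

(** * Mercer expansion and kernel ridge regression *)

Section mercer.
Context d (T : measurableType d) (R : realType) (mu : {measure set T -> \bar R}).
Context (k : T -> T -> R) (H : set (T -> R))
  (ip : (T -> R) -> (T -> R) -> R) (Hr : is_rkhs k H ip).
Context (K : R) (K0 : 0 <= K) (HL2 : H `<=` L2 mu).
Hypothesis HK : forall f, H f -> L2ip mu f f <= K * ip f f.

Let HI := rkhs_semi_inner Hr.
Let LI : semi_inner (L2 mu : set (T -> R)) (L2ip mu) := L2_semi_inner mu.

Lemma kernel_op_rkhs f : L2 mu f -> H (kernel_op mu k f) /\
  forall g, H g -> ip (kernel_op mu k f) g = L2ip mu f g.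
Proof.
move=> Lf; have [||g Hg|h Hh hP] := @riesz _ _ _ _ HI (rkhs_si_complete Hr)
    (L2ip mu f) (L2ip mu f f * K).
- by rewrite mulr_ge0// (si_ge0 LI).
- move=> a g1 g2 /HL2 L1 /HL2 L2'.
  by rewrite (siDr LI) ?(siZr LI)//; exact: (siZ LI).
- apply: le_trans (cauchy_schwarz LI Lf (HL2 Hg)) _.
  by rewrite -mulrA ler_wpM2l ?HK// (si_ge0 LI).
have -> : kernel_op mu k f = h; last by [].
(* The value of the Riesz vector at [x] is its product with [k x], which is the integral defining
   the kernel operator. *)
apply/funext => x; rewrite (rkhs_reproducing Hr x Hh) hP; last exact: rkhs_kernel Hr _.
by apply: eq_Rintegral => y _; rewrite mulrC.
Qed.

Context (a : nat -> T -> R) (sigma : nat -> R) (aE : is_eigensystem mu k a sigma).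
(** This and [a_version] carry the topology into an otherwise measure-theoretic section: continuity
    and nondegeneracy turn almost everywhere equality into equality. *)
Hypothesis H_ae0 : forall f, H f -> {ae mu, forall x, f x = 0} -> f = 0.
Hypothesis a_version : forall n, n \in pos_indices sigma ->
  forall f, H f -> {ae mu, forall x, f x = a n x} -> f = a n.

Let P : pred nat := fun n => n \in pos_indices sigma.

Let sigma_gt0 n : P n -> 0 < sigma n.
Proof. by rewrite /P inE. Qed.

Lemma eigenfunction_rkhs n : P n ->
  H (a n) /\ forall g, H g -> ip (a n) g = L2ip mu (a n) g / sigma n.
Proof.
move=> Pn; have [HT HTip] := kernel_op_rkhs (eigen_L2 aE n).
have s0 : sigma n != 0 by rewrite gt_eqF// sigma_gt0.
have Han : (sigma n)^-1 *: kernel_op mu k (a n) = a n.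
  apply: a_version => //; first exact: (siZ HI).
  apply: filterS (eigen_eq aE n) => x E.
  by rewrite -[LHS]/((sigma n)^-1 * kernel_op mu k (a n) x) E mulKf.
split=> [|g Hg]; first by rewrite -Han; exact: (siZ HI).
by rewrite -{1}Han (siZl HI)// HTip// mulrC.
Qed.

Let aH n : P n -> H (a n).
Proof. by move=> /eigenfunction_rkhs[]. Qed.

Let ip_a g n : P n -> H g -> ip g (a n) = L2ip mu g (a n) / sigma n.
Proof.
move=> Pn Hg; have [Ha aip] := eigenfunction_rkhs Pn.
by rewrite (siC HI)// aip// (siC LI)//; exact: HL2.
Qed.

Let orthH m n : P m -> P n -> ip (a m) (a n) = (m == n)%:R * (sigma n)^-1.
Proof.
by move=> Pm Pn; rewrite ip_a ?(eigen_orthonormal aE)//; exact: aH.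
Qed.

Let orthL m n : P m -> P n -> L2ip mu (a m) (a n) = (m == n)%:R * 1.
Proof. by move=> _ _; rewrite (eigen_orthonormal aE) mulr1. Qed.

Let weightH n : P n -> 0 < (sigma n)^-1.
Proof. by move=> /sigma_gt0; rewrite invr_gt0. Qed.

Let weightL n : P n -> 0 < 1 :> R.
Proof. by []. Qed.

Lemma eigenfunctions_total w : H w -> (forall n, P n -> ip w (a n) = 0) ->
  ip w w = 0.
Proof.
move=> Hw w_orth; have Lw := HL2 Hw; have [HT HTip] := kernel_op_rkhs Lw.
have wa n : P n -> L2ip mu w (a n) = 0.
  move=> Pn; have /eqP := w_orth _ Pn; rewrite ip_a// mulf_eq0 invr_eq0.
  by rewrite (gt_eqF (sigma_gt0 Pn)) orbF => /eqP.
(* All coefficients of [w] vanish, so the sequence in the eigen-expansion is constantly the norm of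
   the image of [w]. *)
have TwN : L2norm mu (kernel_op mu k w) = 0%E.
  have := eigen_expansion aE Lw => /(cvg_lim (@ereal_hausdorff R)) <-.
  apply/esym/cvg_lim => //; apply: cvg_near_cst; apply: nearW => N.
  congr (L2norm _ _); apply/funext => x.
  by rewrite big1 ?subr0// => n Pn; rewrite wa// mulr0 mul0r.
have Tw0 : kernel_op mu k w = 0.
  apply: H_ae0 => //; apply: (L2ip_eq0_ae (HL2 HT)).
  move: TwN; rewrite (L2norm_ip (HL2 HT)) => -[] /eqP; rewrite sqrtr_eq0 => le0.
  by apply/eqP; rewrite eq_le le0 (si_ge0 LI)//; exact: HL2.
have ww : L2ip mu w w = 0 by rewrite -HTip// Tw0 (si0l HI).
have w0 : w = 0 by apply: H_ae0 => //; exact: (L2ip_eq0_ae Lw).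
by rewrite w0 (si0l HI)//; exact: si0 HI.
Qed.

Let SH := fourier_sum ip P a (fun n => (sigma n)^-1).
Let SL := fourier_sum (L2ip mu) P a (fun=> 1).

(** The weight [(sigma n)^-1] cancels the factor in [ip_a]. Since the partial sums agree,
    convergence in [H] passes to L2 through [HK]. *)
Let SHL N g : H g -> SH N g = SL N g.
Proof.
move=> Hg; apply: eq_bigr => n Pn.
by rewrite ip_a// invrK divfK ?divr1// gt_eqF// sigma_gt0.
Qed.

Let cvgH g : H g -> ip (g - SH N g) (g - SH N g) @[N --> \oo] --> 0.
Proof.
exact: (fourier_cvg HI aH weightH orthH (rkhs_si_complete Hr) eigenfunctions_total).
Qed.

Let cvgL g : H g -> L2ip mu (g - SL N g) (g - SL N g) @[N --> \oo] --> 0.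
Proof.
move=> Hg; apply: (@squeeze_cvgr _ _ _ _ (cst 0)
  (fun N => K * ip (g - SH N g) (g - SH N g))).
- near=> N; have HS : H (g - SH N g).
    by apply: (siB HI) => //; exact: (fourier_sumS HI _ aH).
  by rewrite -SHL// HK// (si_ge0 LI)//; exact: HL2.
- exact: cvg_cst.
- by rewrite -[0 in X in _ --> X](mulr0 K); apply: cvgMr; exact: cvgH.
Unshelve. all: by end_near. Qed.

Lemma rkhs_parseval g : H g ->
  \sum_(0 <= n < N | n \in pos_indices sigma) L2ip mu g (a n) ^+ 2 / sigma n
    @[N --> \oo] --> ip g g.
Proof.
move=> Hg; have := parseval HI aH weightH orthH Hg (cvgH Hg).
rewrite (_ : energy _ _ _ _ ^~ g = fun N => \sum_(0 <= n < N | P n)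
  L2ip mu g (a n) ^+ 2 / sigma n)//.
apply/funext => N; apply: eq_bigr => n Pn.
rewrite ip_a// invrK expr_div_n expr2 invfM -!mulrA mulVf ?mulr1//.
by rewrite gt_eqF// sigma_gt0.
Qed.

Lemma closure_parseval p : L2closure mu H p ->
  \sum_(0 <= n < N | n \in pos_indices sigma) L2ip mu p (a n) ^+ 2
    @[N --> \oo] --> L2ip mu p p.
Proof.
move=> [Lp approx].
have aL n : P n -> L2 mu (a n) by move=> /aH/HL2.
have pS : L2ip mu (p - SL N p) (p - SL N p) @[N --> \oo] --> 0.
  apply: (fourier_cvg_closure LI aL weightL orthL HL2 Lp cvgL) => r r0.
  (* The closure is defined with norms, the density argument with squares. *)
  have [|g Hg pg] := approx (Num.sqrt r); first by rewrite sqrtr_gt0.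
  exists g => //; move: pg; rewrite L2norm_ip; last exact: (siB LI Lp (HL2 Hg)).
  by rewrite lte_fin ltr_sqrt.
have := parseval LI aL weightL orthL Lp pS.
rewrite (_ : energy _ _ _ _ ^~ p = fun N => \sum_(0 <= n < N | P n)
  L2ip mu p (a n) ^+ 2)//.
by apply/funext => N; apply: eq_bigr => n Pn; rewrite divr1.
Qed.

Lemma L2closureB p f : L2closure mu H p -> H f -> L2closure mu H (p - f).
Proof.
move=> [Lp approx] Hf; split; first exact: (siB LI Lp (HL2 Hf)).
move=> e e0; have [g Hg pg] := approx _ e0.
exists (g - f); first exact: (siB HI).
rewrite (_ : ((p - f) \- (g - f))%R = (p \- g)%R)//.
by apply/funext => x; rewrite !fctE/=; ring.
Qed.

Lemma L2proj_coef f p n : L2 mu f -> is_L2proj mu H f p -> P n ->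
  L2ip mu p (a n) = L2ip mu f (a n).
Proof.
move=> Lf [[Lp approx] orth] Pn; have Han := aH Pn; have La := HL2 Han.
have : L2ip mu (f \- p)%R (a n) = 0.
  (* [a n] lies in [H] and approximates itself, so it is an admissible test function for the
     projection. *)
  apply: orth; split=> // e e0; exists (a n) => //.
  have L0 : L2 mu 0 := si0 LI.
  rewrite (_ : (a n \- a n)%R = 0); last by apply/funext => x; rewrite /= subrr.
  by rewrite L2norm_ip// (si0l LI)// sqrtr0 lte_fin.
rewrite -[(f \- p)%R]/(f - p) (siBl LI)// => /eqP.
by rewrite subr_eq0 => /eqP.
Qed.

End mercer.

(** * First-order condition of kernel ridge regression *)

Section krr.
Context d (T : measurableType d) (R : realType) (nu : probability (T * T)%type R).
Context (k : T -> T -> R) (H : set (T -> R))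
  (ip : (T -> R) -> (T -> R) -> R) (Hr : is_rkhs k H ip).
Context (HL2 : H `<=` L2 (marginal1 nu)).
Context (A m : T -> R) (LA : L2 nu (A \o snd)) (Lm : L2 (marginal1 nu) m)
  (cm : is_condexp nu A m).

Let HI := rkhs_semi_inner Hr.
Let LI : semi_inner (L2 nu : set (T * T -> R)) (L2ip nu) := L2_semi_inner nu.
Let MI : semi_inner (L2 (marginal1 nu) : set (T -> R)) (L2ip (marginal1 nu)) :=
  L2_semi_inner (marginal1 nu).

Lemma krr_lossE lambda f : H f -> krr_loss nu A ip lambda f =
  (L2ip nu ((A \o snd) - (f \o fst)) ((A \o snd) - (f \o fst))
   + lambda * ip f f)%:E.
Proof.
move=> Hf; have LD := siB LI LA (L2_fst (HL2 Hf)).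
rewrite /krr_loss (rkhs_hnorm_sqr Hr)// EFinD -(L2_integral_sqr LD).
congr (_ + _)%E; apply: eq_integral => z _.
by rewrite real_normK ?num_real.
Qed.

(** Moving from [f] to [f + t *: g] changes the loss by a quadratic polynomial in [t] without
    constant term. As it is nonnegative, its linear coefficient vanishes; [condexp_ip] then replaces
    the data [A] by [m]. *)
Lemma krr_first_order lambda f g : is_krr_minimizer nu A H ip lambda f -> H g ->
  0 <= lambda -> L2ip (marginal1 nu) (m - f) g = lambda * ip f g.
Proof.
move=> [Hf fmin] Hg lambda0; have Lf := HL2 Hf; have Lg := HL2 Hg.
have Lff := L2_fst Lf; have Lgf := L2_fst Lg.
pose D : T * T -> R := (A \o snd) - (f \o fst).
have LD : L2 nu D by exact: (siB LI).
have Dg : L2ip nu D (g \o fst) = L2ip (marginal1 nu) (m - f) g.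
  by rewrite (siBl LI)// (siBl MI)// (condexp_ip LA Lm cm)// L2ip_fst.
have quad t : - 0 <= 2 * t * (lambda * ip f g - L2ip nu D (g \o fst)) +
    t ^+ 2 * (L2ip nu (g \o fst) (g \o fst) + lambda * ip g g).
  have Hfg := siD HI Hf (siZ HI t Hg).
  have := fmin _ Hfg; rewrite !krr_lossE// lee_fin.
  have -> : (A \o snd) - ((f + t *: g) \o fst) = D + (- t) *: (g \o fst).
    by apply/funext => z; rewrite /D !fctE/= /GRing.scale/=; ring.
  rewrite -/D (si_sqrDZ LI)// (si_sqrDZ HI)//; lra.
have := discriminant_le _ quad; rewrite mul0r real_exprn_even_le0//= => h.
rewrite -Dg; apply/eqP; rewrite eq_sym -subr_eq0; apply: h.
by rewrite addr_ge0 ?mulr_ge0 ?(si_ge0 LI)// (si_ge0 HI).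
Qed.

End krr.

(** * Boundedness of the embedding of the RKHS into L2 *)

Section L2_bounds.
Context d (T : measurableType d) (R : realType).

Lemma L2ip_le (mu : {measure set T -> \bar R}) (f g : T -> R) :
  L2 mu f -> L2 mu g -> (forall x, `|f x| <= `|g x|) ->
  L2ip mu f f <= L2ip mu g g.
Proof.
move=> Lf Lg fg; apply: le_Rintegral => //.
- exact: L2_integrableM.
- exact: L2_integrableM.
move=> x _; rewrite /= -!expr2 -[f x ^+ 2]real_normK ?num_real//.
by rewrite -[g x ^+ 2]real_normK ?num_real// ler_pXn2r ?nnegrE.
Qed.

(** By the reproducing property, [|f x|] is at most the norm of [f] in [H] times the root of
    [k x x]. The embedding constant is thus the integral of [k x x]. *)
Lemma rkhs_L2 (mu : {measure set T -> \bar R}) (k : T -> T -> R)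
    (H : set (T -> R)) (ip : (T -> R) -> (T -> R) -> R) (f : T -> R) :
  is_rkhs k H ip -> L2 mu (fun x => Num.sqrt (k x x)) ->
  H f -> measurable_fun setT f ->
  L2 mu f /\ L2ip mu f f <=
    L2ip mu (fun x => Num.sqrt (k x x)) (fun x => Num.sqrt (k x x)) * ip f f.
Proof.
move=> Hr Lk Hf mf; set s := fun x => _ in Lk *.
have LI := L2_semi_inner mu; have f0 := si_ge0 (rkhs_semi_inner Hr) Hf.
have Lg : L2 mu (Num.sqrt (ip f f) *: s) by exact: (siZ LI).
have fg x : `|f x| <= `|(Num.sqrt (ip f f) *: s) x|.
  rewrite -[X in _ <= `|X|]/(Num.sqrt (ip f f) * Num.sqrt (k x x)).
  rewrite -sqrtrM// [leRHS]ger0_norm ?sqrtr_ge0// -sqrtr_sqr ler_sqrt; last first.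
    by apply: le_trans (rkhs_sqr_le Hr x Hf); exact: sqr_ge0.
  exact: (rkhs_sqr_le Hr).
have Lf := L2_le mf fg Lg; split=> //.
by apply: le_trans (L2ip_le Lf Lg fg) _; rewrite (si_sqrZ LI)// sqr_sqrtr// mulrC.
Qed.

End L2_bounds.

(** Since [Pm] is only a representative, its class belonging to [H] is expressed by some [h] in [H]
    equal to it almost everywhere, and the norm of [H] is taken on [h]. *)
Theorem theorem3p5 (R : realType) (d : nat) (X : set 'rV[R]_d)
  (X0 : X !=set0) (Xopen : open X)
  (nu : probability (domain X0 * domain X0)%type R)
  (nu_P2 : (\int[nu]_z (enorm z.1 ^+ 2 + enorm z.2 ^+ 2)%:E < +oo)%E)
  (A : domain X0 -> R) (A_meas : measurable_fun setT A)
  (A_growth : exists2 C : R, 0 < C & forall x, `|A x| <= C * (1 + enorm x))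
  (k : domain X0 -> domain X0 -> R)
  (k_sym : symmetric_kernel k) (k_pd : posdef_kernel k)
  (k_cont : continuous (fun z : domain X0 * domain X0 => k z.1 z.2))
  (k_growth : exists2 C : R, 0 < C &
    forall x, 0 < k x x <= C * (1 + enorm x ^+ 2))
  (H : set (domain X0 -> R))
  (ip : (domain X0 -> R) -> (domain X0 -> R) -> R)
  (H_rkhs : is_rkhs k H ip)
  (nu_nondeg : forall U : set (domain X0),
    open U -> U !=set0 -> (0 < marginal1 nu U)%E)
  (m : domain X0 -> R) (m_condexp : is_condexp nu A m)
  (m_L2 : L2 (marginal1 nu) m)
  (a : nat -> domain X0 -> R) (sigma : nat -> R)
  (a_eigen : is_eigensystem (marginal1 nu) k a sigma)
  (a_cont : forall n, n \in pos_indices sigma -> continuous (a n))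
  (mreg : R -> domain X0 -> R)
  (mreg_min : forall lambda, 0 < lambda ->
    is_krr_minimizer nu A H ip lambda (mreg lambda))
  (Pm : domain X0 -> R) (Pm_proj : is_L2proj (marginal1 nu) H m Pm) :
  [/\ forall lambda, 0 < lambda ->
        (L2norm (marginal1 nu) (Pm \- mreg lambda)%R ^+ 2 =
         \esum_(n in pos_indices sigma)
           (lambda ^+ 2 / (sigma n + lambda) ^+ 2
            * L2ip (marginal1 nu) m (a n) ^+ 2)%:E)%E,
      L2norm (marginal1 nu) (Pm \- mreg lambda)%R @[lambda --> 0^'+] --> 0%E
    & forall h, H h -> {ae marginal1 nu, forall x, h x = Pm x} ->
      (forall lambda, 0 < lambda ->
        ((hnorm ip (h \- mreg lambda)%R ^+ 2)%:E =
         \esum_(n in pos_indices sigma)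
           (lambda ^+ 2 / ((sigma n + lambda) ^+ 2 * sigma n)
            * L2ip (marginal1 nu) m (a n) ^+ 2)%:E)%E) /\
      hnorm ip (h \- mreg lambda)%R @[lambda --> 0^'+] --> (0 : R)].
Proof.
set mu := marginal1 nu.
have LIn := L2_semi_inner nu; have LI := L2_semi_inner mu.
have HI := rkhs_semi_inner H_rkhs.
have me : measurable_fun setT (@enorm R d X X0).
  by apply: domain_continuous_measurable; exact: enorm_continuous.
have e0 (x : domain X0) : 0 <= enorm x by exact: sqrtr_ge0.
have enorm_part (p : domain X0 * domain X0 -> domain X0) :
    measurable_fun setT p ->
    (forall z, enorm (p z) ^+ 2 <= enorm z.1 ^+ 2 + enorm z.2 ^+ 2) ->
    L2 nu (@enorm R d X X0 \o p).
  move=> mp pz; have mep := measurableT_comp me mp.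
  apply: L2_of_sqr => //; apply: le_lt_trans nu_P2.
  apply: ge0_le_integral => //.
  - by move=> z _; rewrite lee_fin sqr_ge0.
  - by apply/measurable_EFinP; apply: measurable_funX; exact: mep.
  - apply/measurable_EFinP; apply: measurable_funD; apply: measurable_funX.
      exact: measurableT_comp me measurable_fst.
    exact: measurableT_comp me measurable_snd.
  - by move=> z _; rewrite lee_fin; exact: pz.
have L2e1 : L2 nu (@enorm R d X X0 \o fst).
  by apply: enorm_part => // z; rewrite lerDl sqr_ge0.
have L2e2 : L2 nu (@enorm R d X X0 \o snd).
  by apply: enorm_part => // z; rewrite lerDr sqr_ge0.
have L2e : L2 mu (@enorm R d X X0).
  apply: L2_of_sqr => //; rewrite ge0_integral_marginal1.
  - by have /integrable_lty := L2_integrable_sqr L2e1; exact.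
  - exact: measurable_funX.
  - by move=> x; exact: sqr_ge0.
have LA : L2 nu (A \o snd).
  have [C C0 AC] := A_growth.
  have Lg : L2 nu (C *: (cst 1 + (@enorm R d X X0 \o snd))).
    by apply: (siZ LIn); apply: (siD LIn) => //; exact: L2_cst.
  apply: L2_le Lg; first exact: measurableT_comp A_meas measurable_snd.
  move=> z; apply: le_trans (AC z.2) _.
  by rewrite -[X in _ <= `|X|]/(C * (1 + enorm z.2)) ler_norm.
have cont_rkhs f : H f -> continuous f by exact: rkhs_continuous H_rkhs k_cont.
have L2k : L2 mu (fun x => Num.sqrt (k x x)).
  have [C C0 kC] := k_growth.
  (* The dominating function comes from [1 + r ^+ 2 <= (1 + r) ^+ 2] for [0 <= r]. *)
  have Lg : L2 mu (Num.sqrt C *: (cst 1 + @enorm R d X X0)).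
    by apply: (siZ LI); apply: (siD LI) => //; exact: L2_cst.
  apply: L2_le Lg => [|x].
    apply: domain_continuous_measurable => x.
    apply: (@continuous_comp _ _ _ (fun x => k x x) Num.sqrt); last first.
      exact: sqrt_continuous.
    exact: (diagonal_continuous k_cont).
  rewrite -[X in _ <= `|X|]/(Num.sqrt C * (1 + enorm x)).
  have := kC x => /andP[_ kxC]; have ex := e0 x; have C0' := ltW C0.
  have -> : Num.sqrt C * (1 + enorm x) = Num.sqrt (C * (1 + enorm x) ^+ 2).
    by rewrite sqrtrM// sqrtr_sqr ger0_norm// addr_ge0.
  rewrite !ger0_norm ?sqrtr_ge0// ler_sqrt; last by rewrite mulr_ge0// sqr_ge0.
  apply: le_trans kxC _; rewrite ler_pM2l//; lra.
have HL f : H f -> L2 mu f /\ L2ip mu f f <= _ := fun Hf =>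
  rkhs_L2 H_rkhs L2k Hf (domain_continuous_measurable (cont_rkhs f Hf)).
set K := L2ip mu _ _ in HL.
have K0 : 0 <= K by exact: (si_ge0 LI).
have HL2 : H `<=` L2 mu by move=> f /HL[].
have HK f : H f -> L2ip mu f f <= K * ip f f by move=> /HL[].
have H_ae0 f : H f -> {ae mu, forall x, f x = 0} -> f = 0.
  move=> Hf; apply: (domain_ae_eq nu_nondeg (cont_rkhs _ Hf)).
  exact: (@cst_continuous _ _ (0 : R)).
have a_version n : n \in pos_indices sigma -> forall f, H f ->
    {ae mu, forall x, f x = a n x} -> f = a n.
  move=> Pn f Hf; apply: (domain_ae_eq nu_nondeg); first exact: cont_rkhs.
  exact: a_cont.
pose P n := n \in pos_indices sigma.
have s0 n : P n -> 0 < sigma n by rewrite /P inE.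
have esumP (f : nat -> R) l : (forall n, P n -> 0 <= f n) ->
    \sum_(0 <= n < N | P n) f n @[N --> \oo] --> l ->
    (\esum_(n in pos_indices sigma) (f n)%:E = l%:E)%E.
  move=> f0 /(esum_cvg f0) <-; congr esum; apply/seteqP.
  by split=> n; rewrite /= /P inE.
have aP n : P n -> H (a n) /\ forall g, H g -> ip (a n) g = L2ip mu (a n) g / sigma n.
  by move=> Pn; exact: (eigenfunction_rkhs H_rkhs K0 HL2 HK a_eigen a_version).
pose c n := L2ip mu m (a n).
have Lp : L2 mu Pm by case: Pm_proj => -[].
have mregH lambda : 0 < lambda -> H (mreg lambda) by move=> /mreg_min[].
have cP n : P n -> L2ip mu Pm (a n) = c n.
  by move=> Pn; exact: (L2proj_coef H_rkhs K0 HL2 HK a_eigen a_version m_L2).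
(* Stated for every [p] with coefficients [c n], to cover both [Pm] and [h]. With [x] the
   coefficient of [mreg lambda], the first-order condition reads
   [(c n - x) * sigma n = lambda * x]. *)
have coef lambda p n : 0 < lambda -> P n -> L2 mu p -> L2ip mu p (a n) = c n ->
    L2ip mu (p - mreg lambda) (a n) = lambda / (sigma n + lambda) * c n.
  move=> l0 Pn Lp' pc; have [Han aip] := aP _ Pn; have Hl := mregH _ l0.
  have := krr_first_order H_rkhs HL2 LA m_L2 m_condexp (mreg_min _ l0) Han (ltW l0).
  rewrite (siC HI Hl Han) aip// !(siBl LI) ?pc; try by [exact: HL2|].
  rewrite (siC LI (HL2 _ Han) (HL2 _ Hl)) -/(c n); set x := L2ip mu _ _ => E.
  have sn := s0 _ Pn; have sl : sigma n + lambda != 0 by rewrite gt_eqF// addr_gt0.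
  have sn0 : sigma n != 0 by rewrite gt_eqF.
  have {}E : (c n - x) * sigma n = lambda * x by rewrite E -mulrA divfK.
  apply: (mulfI sl); rewrite mulrA [_ * (lambda / _)]mulrCA divff// mulr1.
  by move: E; lra.
have clp lambda : 0 < lambda -> L2closure mu H (Pm - mreg lambda).
  by move=> l0; apply: (L2closureB H_rkhs HL2); [case: Pm_proj|exact: mregH].
pose F lambda := L2ip mu (Pm - mreg lambda) (Pm - mreg lambda).
have cF lambda : 0 < lambda -> \sum_(0 <= n < N | P n)
    (lambda ^+ 2 / (sigma n + lambda) ^+ 2 * c n ^+ 2) @[N --> \oo] --> F lambda.
  move=> l0; have := closure_parseval H_rkhs K0 HL2 HK a_eigen H_ae0 a_version (clp _ l0).
  apply: cvg_trans; apply: near_eq_cvg; apply: nearW => N; apply: eq_bigr => n Pn.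
  by rewrite coef ?cP// exprMn expr_div_n.
have normF lambda : 0 < lambda ->
    L2norm mu (Pm \- mreg lambda)%R = (Num.sqrt (F lambda))%:E.
  by move=> l0; rewrite L2norm_ip//; exact: (siB LI Lp (HL2 _ (mregH _ l0))).
have F0 lambda : 0 < lambda -> 0 <= F lambda.
  by move=> l0; apply: (si_ge0 LI); exact: (siB LI Lp (HL2 _ (mregH _ l0))).
split.
- move=> lambda l0; rewrite normF// -EFin_expe sqr_sqrtr ?F0//.
  apply/esym/esumP; last exact: cF.
  by move=> n Pn; rewrite mulr_ge0 ?divr_ge0 ?sqr_ge0.
- have Fl : F lambda @[lambda --> 0^'+] --> 0.
    (* The weights [c n ^+ 2] are summable by Parseval for [Pm] in the closure. *)
    apply: (ridge_filter_cvg0 s0 _ _ cF) => [n _|]; first exact: sqr_ge0.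
    apply/cvg_ex; exists (L2ip mu Pm Pm).
    have := closure_parseval H_rkhs K0 HL2 HK a_eigen H_ae0 a_version Pm_proj.1.
    apply: cvg_trans; apply: near_eq_cvg; apply: nearW => N; apply: eq_bigr => n Pn.
    by rewrite cP.
  have : (Num.sqrt (F lambda))%:E @[lambda --> 0^'+] --> 0%:E.
    by apply: cvg_EFin; [exact: nearW|exact: cvg0_sqrt Fl].
  apply: cvg_trans; apply: near_eq_cvg; near=> lambda.
  by apply/esym/normF.
- move=> h Hh hPm.
  (* [h] and [Pm] differ by a null vector, which is orthogonal to everything by Cauchy-Schwarz. *)
  have hc n : P n -> L2ip mu h (a n) = c n.
    move=> Pn; have [Han _] := aP _ Pn; rewrite -cP//; apply/eqP.
    rewrite -subr_eq0 -(siBl LI)//; [|exact: HL2..].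
    have LhP := siB LI (HL2 _ Hh) Lp.
    rewrite (siC LI)//; last exact: HL2.
    rewrite (si_sqr0 LI)//; first exact: HL2.
    apply: L2ip_ae0 => //; apply: filterS hPm => x hx.
    by rewrite -[LHS]/(h x - Pm x) hx subrr.
  pose G lambda := ip (h - mreg lambda) (h - mreg lambda).
  have Hhm lambda : 0 < lambda -> H (h - mreg lambda).
    by move=> l0; apply: (siB HI) => //; exact: mregH.
  have cG lambda : 0 < lambda -> \sum_(0 <= n < N | P n)
      (lambda ^+ 2 / (sigma n + lambda) ^+ 2 * (c n ^+ 2 / sigma n))
      @[N --> \oo] --> G lambda.
    move=> l0; have := rkhs_parseval H_rkhs K0 HL2 HK a_eigen H_ae0 a_version (Hhm _ l0).
    apply: cvg_trans; apply: near_eq_cvg; apply: nearW => N; apply: eq_bigr => n Pn.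
    by rewrite (coef _ _ _ l0 Pn (HL2 _ Hh) (hc _ Pn)) exprMn expr_div_n; ring.
  have c0 n : P n -> 0 <= c n ^+ 2 / sigma n.
    by move=> /s0/ltW sn; rewrite divr_ge0// sqr_ge0.
  split.
    move=> lambda l0; rewrite (rkhs_hnorm_sqr H_rkhs (Hhm _ l0)).
    apply/esym; rewrite -[RHS]/((G lambda)%:E).
    rewrite -(esumP _ _ _ (cG _ l0)); last first.
      by move=> n Pn; rewrite mulr_ge0 ?c0// divr_ge0 ?sqr_ge0.
    by apply: eq_esum => n _; rewrite invfM -/(c n); congr EFin; ring.
  have Gl : G lambda @[lambda --> 0^'+] --> 0.
    (* The weights are now [c n ^+ 2 / sigma n], with sum [ip h h] by Parseval in [H]. *)
    apply: (ridge_filter_cvg0 s0 c0 _ cG).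
    apply/cvg_ex; exists (ip h h).
    have := rkhs_parseval H_rkhs K0 HL2 HK a_eigen H_ae0 a_version Hh.
    apply: cvg_trans; apply: near_eq_cvg; apply: nearW => N; apply: eq_bigr => n Pn.
    by rewrite hc.
  exact: cvg0_sqrt Gl.
Unshelve. all: by end_near. Qed.
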